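(* Let $r=\sqrt{3(t+2)(t+7)(3t^2+3t+2)}$. The functions $$T_{42}=\frac12+\frac{27t^{10}+270t^9+945t^8+2160t^7+2745t^6+1926t^5-5t^4-1340t^3-1440t^2-720t-216}{6(t+2)^2(t^2+1)^2(3t^2+3t+2)\,r},$$ $$y_{42}=\frac12+\frac{(t+7)(45t^6+144t^5+258t^4+228t^3+121t^2+24t-12)}{6(5t^2+4t+3)(t^2+1)(t+2)\,r}$$ (with the same branch of $r$ in both) parametrize an algebraic solution $y_{42}(T_{42})$ of the sixth Painlev\'e equation $P_{VI}(1/3,1/3,1/2,4/5;T_{42})$.
   Context: $P_{VI}(\theta_0,\theta_1,\theta_T,\theta_\infty;T)$ denotes the sixth Painlev\'e equation $$\begin{aligned}\frac{d^2y}{dT^2}={}&\frac12\left(\frac1y+\frac1{y-1}+\frac1{y-T}\right)\left(\frac{dy}{dT}\right)^2-\left(\frac1T+\frac1{T-1}+\frac1{y-T}\right)\frac{dy}{dT}\\&+\frac{y(y-1)(y-T)}{T^2(T-1)^2}\left(\alpha+\beta\frac{T}{y^2}+\gamma\frac{T-1}{(y-1)^2}+\delta\frac{T(T-1)}{(y-T)^2}\right)\end{aligned}$$ for $y=y(T)$, with $\alpha=\frac{(\theta_\infty-1)^2}{2}$, $\beta=-\frac{\theta_0^2}{2}$, $\gamma=\frac{\theta_1^2}{2}$, $\delta=\frac{1-\theta_T^2}{2}$. That functions $T$ and $y$ on the algebraic curve with coordinates $(t,r)$ parametrize a solution means that $T$ is non-constant and that $y$, viewed locally as a function of $T$, satisfies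 the equation. *)

(* Defs.v *)
From Stdlib Require Import Reals.
From Coquelicot Require Import Coquelicot.

Open Scope C_scope.

(* The value that P_VI(th0, th1, thT, thoo) prescribes for y'' at the point T
   of the complex line, in terms of y and p = y'. *)
Definition PVI_rhs (th0 th1 thT thoo T y p : C) : C :=
  let alpha := (thoo - 1) ^ 2 / 2 in
  let beta := - (th0 ^ 2 / 2) in
  let gamma := th1 ^ 2 / 2 in
  let delta := (1 - thT ^ 2) / 2 in
  1 / 2 * (1 / y + 1 / (y - 1) + 1 / (y - T)) * p ^ 2
  - (1 / T + 1 / (T - 1) + 1 / (y - T)) * p
  + y * (y - 1) * (y - T) / (T ^ 2 * (T - 1) ^ 2)
    * (alpha + beta * (T / y ^ 2) + gamma * ((T - 1) / (y - 1) ^ 2)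
       + delta * (T * (T - 1) / (y - T) ^ 2)).

(* The pairs (T, y) at which no denominator of PVI_rhs vanishes; this has to be
   required explicitly because division by zero in C is total. *)
Definition PVI_regular (T y : C) : Prop :=
  T <> 0 /\ T <> 1 /\ y <> 0 /\ y <> 1 /\ y <> T.

(* Derivatives are complex: [is_derive] is taken over the field C. *)
Definition solves_PVI (th0 th1 thT thoo : C) (U : C -> Prop) (Y : C -> C) : Prop :=
  exists Y' Y'' : C -> C, forall s : C, U s ->
    PVI_regular s (Y s) /\
    is_derive Y s (Y' s) /\ is_derive Y' s (Y'' s) /\
    Y'' s = PVI_rhs th0 th1 thT thoo s (Y s) (Y' s).

(* A local holomorphic inverse of the function T on the curve E: a holomorphic
   map s |-> (tau s, rho s) from the open set U into E with T (tau s, rho s) = s. *)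
Definition local_inverse (E : C -> C -> Prop) (T : C -> C -> C)
    (U : C -> Prop) (tau rho : C -> C) : Prop :=
  open U /\
  forall s : C, U s ->
    ex_derive tau s /\ ex_derive rho s /\
    E (tau s) (rho s) /\ T (tau s) (rho s) = s.

(* E is the set of points (t, r) of an irreducible affine curve at which T and y
   are finite.  The function y, viewed locally as a function of T, is
   s |-> y (tau s, rho s) for a local inverse (tau, rho) of T.  Since T is
   non-constant, local inverses exist near all but finitely many points of E.
   The second clause says that y is none of the functions 0, 1, T, for which the
   equation has no meaning, so that the restriction to regular values in the
   third clause removes only finitely many further points. *)
Definition parametrizes_PVI_solution (th0 th1 thT thoo : C)
    (E : C -> C -> Prop) (T y : C -> C -> C) : Prop :=
  (exists t1 r1 t2 r2 : C, E t1 r1 /\ E t2 r2 /\ T t1 r1 <> T t2 r2) /\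
  (exists t r : C, E t r /\ PVI_regular (T t r) (y t r)) /\
  (forall (U : C -> Prop) (tau rho : C -> C),
     local_inverse E T U tau rho ->
     (forall s : C, U s -> PVI_regular s (y (tau s) (rho s))) ->
     solves_PVI th0 th1 thT thoo U (fun s => y (tau s) (rho s))).

Definition T42_den (t r : C) : C :=
  6 * (t + 2) ^ 2 * (t ^ 2 + 1) ^ 2 * (3 * t ^ 2 + 3 * t + 2) * r.

Definition T42 (t r : C) : C :=
  1 / 2 +
  (27 * t ^ 10 + 270 * t ^ 9 + 945 * t ^ 8 + 2160 * t ^ 7 + 2745 * t ^ 6
   + 1926 * t ^ 5 - 5 * t ^ 4 - 1340 * t ^ 3 - 1440 * t ^ 2 - 720 * t - 216)
  / T42_den t r.

Definition y42_den (t r : C) : C :=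
  6 * (5 * t ^ 2 + 4 * t + 3) * (t ^ 2 + 1) * (t + 2) * r.

Definition y42 (t r : C) : C :=
  1 / 2 +
  (t + 7) * (45 * t ^ 6 + 144 * t ^ 5 + 258 * t ^ 4 + 228 * t ^ 3
             + 121 * t ^ 2 + 24 * t - 12)
  / y42_den t r.

(* The curve r^2 = 3(t+2)(t+7)(3t^2+3t+2), minus the finitely many points at
   which a denominator of T42 or y42 vanishes. *)
Definition curve42 (t r : C) : Prop :=
  r ^ 2 = 3 * (t + 2) * (t + 7) * (3 * t ^ 2 + 3 * t + 2) /\
  T42_den t r <> 0 /\ y42_den t r <> 0.

(* Main.v *)
Require Import Defs.
From Stdlib Require Import Reals ZArith Lra.
From Coquelicot Require Import Coquelicot.

Open Scope C_scope.

(** The curve r^2 = rad t has the involution r -> -r.  As T and y are each 1/2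
    plus an odd function of r, it acts as (T, y) -> (1 - T, 1 - y), and this is a
    symmetry of the equation because theta_0 = theta_1.
    So both sides of the equation are r times a rational function of t alone, and
    the whole claim reduces to one identity in Q(t).

    The identity is accessible because the relevant functions factor.  Write
    T = 1/2 + T_odd / r and y = 1/2 + y_odd / r.  Then T (T - 1) = T_prod,
    y (y - 1) = y_prod, y - T = gap / r and dT/dt = T_speed / r, where T_prod, gap
    and T_speed have the three factors 3t^2+2t+2, 2t^2+3t+3, 3t+1 in common: T
    ramifies over 0 and 1 at their zeros.  Hence dy/dT is a rational function
    [slope] of t, and its derivative with respect to T is r * slope' / T_speed.
    After the equation has been written through T (T - 1), y (y - 1) and y - T in
    [PVI_rhs_symmetric], the remaining identity is [PVI_reduced].

    For a local inverse (tau, rho) of T, differentiating T (tau s, rho s) = s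
    gives tau' = rho / T_speed tau; where the values T, y are regular, none of
    T_prod, y_prod, gap vanishes, so neither does T_speed, and the chain rule
    yields y' and y'' in [curve42_solves_PVI].  For the two existence clauses the
    points (1, 24) and (1, -24) serve, since rad 1 = 24^2. *)

(** * Ring computations in C with integer coefficients *)

(** Integer literals are made constants of the ring structure, so that [ring] and
    [field] decide identities with numerical coefficients by computing in Z. *)
Definition C_of_Z (z : Z) : C := RtoC (IZR z).

Lemma C_of_Z_morph :
  ring_morph (0 : C) 1 Cplus Cmult Cminus Copp eq
    0%Z 1%Z Z.add Z.mul Z.sub Z.opp Z.eqb C_of_Z.
Proof.
  constructor; unfold C_of_Z; intros; try reflexivity.
  - now rewrite plus_IZR, RtoC_plus.
  - now rewrite minus_IZR, RtoC_minus.
  - now rewrite mult_IZR, RtoC_mult.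
  - now rewrite opp_IZR, RtoC_opp.
  - f_equal; f_equal; now apply Z.eqb_eq.
Qed.

Lemma C_of_Z_inj (x y : Z) : C_of_Z x = C_of_Z y -> Z.eqb x y = true.
Proof. intros H; apply Z.eqb_eq, eq_IZR, RtoC_inj, H. Qed.

Lemma Cpow_power_theory : power_theory (1 : C) Cmult eq N.to_nat Cpow.
Proof.
  constructor; intros x [|p]; [reflexivity|].
  change (x ^ Pos.to_nat p = pow_pos Cmult x p).
  induction p as [p IH|p IH|].
  - rewrite Pos2Nat.inj_xI; cbn [pow_pos]; rewrite <- IH.
    change (x ^ S (2 * Pos.to_nat p)) with (x * x ^ (2 * Pos.to_nat p)).
    now rewrite <- Cpow_add_r; simpl; rewrite Nat.add_0_r.
  - rewrite Pos2Nat.inj_xO; cbn [pow_pos]; rewrite <- IH.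
    now rewrite <- Cpow_add_r; simpl; rewrite Nat.add_0_r.
  - apply Cmult_1_r.
Qed.

Ltac C_constant x :=
  match x with
  | RtoC (IZR ?z) => match isZcst z with true => z | _ => constr:(NotConstant) end
  | _ => constr:(NotConstant)
  end.

Ltac nat_to_N k :=
  match isnatcst k with
  | true => let v := eval compute in (N.of_nat k) in v
  | _ => constr:(NotConstant)
  end.

Add Field C_Z_field : C_field_theory
  (morphism C_of_Z_morph, completeness C_of_Z_inj, constants [C_constant],
   power_tac Cpow_power_theory [nat_to_N]).

(** * Complex derivatives *)

Notation is_derive_C f z l :=
  (@is_derive C_AbsRing C_NormedModule (f : C -> C) (z : C) (l%C : C)).

(** C carries two normed-module structures over itself, whose uniform structures
    are balls of C and squares in R * R.  The derivative involves only the norm of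
    the target, which is the modulus in both; the product and composition rules
    refer to the first structure, the definitions above to the second. *)
Lemma is_derive_AbsRing_C (f : C -> C) (z l : C) :
  @is_derive C_AbsRing (AbsRing_NormedModule C_AbsRing) f z l <-> is_derive_C f z l.
Proof.
  split; intros [_ H].
  - split; [apply (is_linear_scal_l (K := C_AbsRing) (V := C_NormedModule)) | exact H].
  - split; [apply (is_linear_scal_l (K := C_AbsRing) (V := AbsRing_NormedModule C_AbsRing)) | exact H].
Qed.

Lemma is_derive_C_const (c z : C) : is_derive_C (fun _ => c) z 0.
Proof. exact (is_derive_const (K := C_AbsRing) (V := C_NormedModule) c z). Qed.

Lemma is_derive_C_id (z : C) : is_derive_C (fun w => w) z 1.
Proof. apply is_derive_AbsRing_C, (is_derive_id (K := C_AbsRing) z). Qed.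

Lemma is_derive_C_plus (f g : C -> C) (z df dg : C) :
  is_derive_C f z df -> is_derive_C g z dg ->
  is_derive_C (fun w => f w + g w) z (df + dg).
Proof. exact (is_derive_plus (K := C_AbsRing) (V := C_NormedModule) f g z df dg). Qed.

Lemma is_derive_C_minus (f g : C -> C) (z df dg : C) :
  is_derive_C f z df -> is_derive_C g z dg ->
  is_derive_C (fun w => f w - g w) z (df - dg).
Proof. exact (is_derive_minus (K := C_AbsRing) (V := C_NormedModule) f g z df dg). Qed.

Lemma is_derive_C_opp (f : C -> C) (z df : C) :
  is_derive_C f z df -> is_derive_C (fun w => - f w) z (- df).
Proof. exact (is_derive_opp (K := C_AbsRing) (V := C_NormedModule) f z df). Qed.

Lemma is_derive_C_mult (f g : C -> C) (z df dg : C) :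
  is_derive_C f z df -> is_derive_C g z dg ->
  is_derive_C (fun w => f w * g w) z (df * g z + f z * dg).
Proof.
  intros Hf%is_derive_AbsRing_C Hg%is_derive_AbsRing_C. apply is_derive_AbsRing_C.
  exact (is_derive_mult (K := C_AbsRing) f g z df dg Hf Hg Cmult_comm).
Qed.

Lemma is_derive_C_comp (f g : C -> C) (z df dg : C) :
  is_derive_C f (g z) df -> is_derive_C g z dg ->
  is_derive_C (fun w => f (g w)) z (dg * df).
Proof.
  intros Hf Hg%is_derive_AbsRing_C.
  exact (is_derive_comp (K := C_AbsRing) (V := C_NormedModule) f g z df dg Hf Hg).
Qed.

(** The error term 1/w - 1/z + (w - z)/z^2 equals (w - z)^2 / (w z^2), and
    |w| >= |z|/2 near z. *)
Lemma is_derive_C_inv_id (z : C) : z <> 0 -> is_derive_C Cinv z (- / z ^ 2).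
Proof.
  intros Hz. split; [apply (is_linear_scal_l (K := C_AbsRing) (V := C_NormedModule))|].
  intros x Hx eps.
  rewrite <- (is_filter_lim_locally_unique _ _ Hx).
  assert (Hp : (0 < Cmod z)%R) by now apply Cmod_gt_0.
  assert (Hd : (0 < Rmin (Cmod z / 2) (eps * Cmod z ^ 3 / 2))%R).
  { apply Rmin_pos; [lra|]. pose proof (cond_pos eps). pose proof (pow_lt _ 3 Hp). nra. }
  exists (mkposreal _ Hd). intros w Hw.
  change C in w.
  change (Cmod (w - z) < Rmin (Cmod z / 2) (eps * Cmod z ^ 3 / 2))%R in Hw.
  change (Cmod (/ w - / z - (w - z) * (- / z ^ 2)) <= eps * Cmod (w - z))%R.
  pose proof (Rmin_l (Cmod z / 2) (eps * Cmod z ^ 3 / 2)) as H1.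
  pose proof (Rmin_r (Cmod z / 2) (eps * Cmod z ^ 3 / 2)) as H2.
  assert (Hwz : (Cmod z / 2 <= Cmod w)%R).
  { pose proof (Cmod_triangle (z - w) w) as Ht.
    replace (z - w + w) with z in Ht by ring.
    replace (z - w) with (- (w - z)) in Ht by ring.
    rewrite Cmod_opp in Ht. lra. }
  assert (Hw0 : w <> 0) by (apply Cmod_gt_0; lra).
  replace (/ w - / z - (w - z) * (- / z ^ 2)) with ((w - z) * (w - z) / (w * z ^ 2))
    by (field; auto).
  rewrite Cmod_div, !Cmod_mult, Cmod_pow by (apply Cmult_neq_0; [|apply Cpow_nz]; auto).
  apply Rle_div_l; [apply Rmult_lt_0_compat; [lra | now apply pow_lt]|].
  rewrite Rmult_assoc, (Rmult_comm eps), Rmult_assoc.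
  apply Rmult_le_compat_l; [apply Cmod_ge_0|].
  pose proof (cond_pos eps). pose proof (pow_lt _ 2 Hp).
  apply Rle_trans with (eps * (Cmod z / 2 * Cmod z ^ 2))%R; [simpl in *; lra|].
  rewrite (Rmult_comm _ eps).
  apply Rmult_le_compat_l; [lra|]. apply Rmult_le_compat_r; lra.
Qed.

Lemma is_derive_C_div (f g : C -> C) (z df dg : C) :
  g z <> 0 -> is_derive_C f z df -> is_derive_C g z dg ->
  is_derive_C (fun w => f w / g w) z ((df * g z - f z * dg) / g z ^ 2).
Proof.
  intros H0 Hf Hg.
  pose proof (is_derive_C_mult _ _ _ _ _ Hf
    (is_derive_C_comp _ _ _ _ _ (is_derive_C_inv_id _ H0) Hg)) as H.
  replace ((df * g z - f z * dg) / g z ^ 2)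
    with (df * / g z + f z * (dg * - / g z ^ 2)) by (field; assumption).
  exact H.
Qed.

Lemma is_derive_C_pow (f : C -> C) (k : nat) (z df : C) :
  is_derive_C f z df ->
  is_derive_C (fun w => f w ^ k) z (IZR (Z.of_nat k) * df * f z ^ pred k).
Proof.
  intros Hf. induction k as [|k IH].
  - replace (IZR (Z.of_nat 0) * df * f z ^ pred 0) with (RtoC 0) by (simpl; ring).
    exact (is_derive_C_const 1 z).
  - replace (IZR (Z.of_nat (S k)) * df * f z ^ pred (S k))
      with (df * f z ^ k + f z * (IZR (Z.of_nat k) * df * f z ^ pred k)).
    + exact (is_derive_C_mult _ _ _ _ _ Hf IH).
    + rewrite Nat2Z.inj_succ, succ_IZR, RtoC_plus.
      destruct k; simpl; ring.
Qed.

Lemma is_derive_C_unique (f : C -> C) (z l1 l2 : C) :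
  is_derive_C f z l1 -> is_derive_C f z l2 -> l1 = l2.
Proof.
  intros H1 H2. now rewrite <- (is_C_derive_unique f z l1 H1), (is_C_derive_unique f z l2 H2).
Qed.

Lemma is_derive_C_eq (f : C -> C) (z l l' : C) :
  is_derive_C f z l -> l = l' -> is_derive_C f z l'.
Proof. now intros H <-. Qed.

(** The open sets of the statement are those of R * R, whereas the derivative looks
    at neighbourhoods for the modulus; [locally_C] identifies them. *)
Lemma is_derive_C_ext_open (U : C -> Prop) (f g : C -> C) (z l : C) :
  open (U : C_UniformSpace -> Prop) -> U z -> (forall w, U w -> f w = g w) ->
  is_derive_C f z l -> is_derive_C g z l.
Proof.
  intros HU Hz Heq. apply (is_derive_ext_loc (K := C_AbsRing) (V := C_NormedModule)).
  apply locally_C. apply (filter_imp U); [exact Heq | exact (HU z Hz)].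
Qed.

(** One step of symbolic differentiation; the derivative is left to unification. *)
Ltac derive_C :=
  lazymatch goal with
  | |- is_derive (fun w => @?f w + @?g w) _ _ => refine (is_derive_C_plus f g _ _ _ _ _)
  | |- is_derive (fun w => @?f w - @?g w) _ _ => refine (is_derive_C_minus f g _ _ _ _ _)
  | |- is_derive (fun w => @?f w * @?g w) _ _ => refine (is_derive_C_mult f g _ _ _ _ _)
  | |- is_derive (fun w => @?f w / @?g w) _ _ => refine (is_derive_C_div f g _ _ _ _ _ _)
  | |- is_derive (fun w => - @?f w) _ _ => refine (is_derive_C_opp f _ _ _)
  | |- is_derive (fun w => (@?f w) ^ ?k) _ _ => refine (is_derive_C_pow f k _ _ _)
  | |- is_derive (fun w => w) _ _ => refine (is_derive_C_id _)
  | |- is_derive (fun _ => ?c) _ _ => refine (is_derive_C_const c _)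
  end.

Lemma RtoC_neq (x y : R) : x <> y -> RtoC x <> RtoC y.
Proof. intros H H'. exact (H (RtoC_inj _ _ H')). Qed.

Lemma Cinv_neq_0 (z : C) : z <> 0 -> / z <> 0.
Proof.
  intros Hz H. apply (RtoC_neq 1 0 R1_neq_R0).
  rewrite <- (Cinv_r z Hz), H. ring.
Qed.

Ltac product_neq_0 :=
  lazymatch goal with
  | |- _ * _ <> _ => apply Cmult_neq_0; product_neq_0
  | |- _ ^ _ <> _ => apply Cpow_nz; product_neq_0
  | |- / _ <> _ => apply Cinv_neq_0; product_neq_0
  | |- RtoC _ <> _ => apply RtoC_neq; lra
  | |- _ => assumption
  end.

(** Coefficients and exponents produced by the power rule become literals that
    [ring] can read. *)
Ltac simpl_derivative :=
  cbn [Z.of_nat Pos.of_succ_nat Pos.succ Init.Nat.pred].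

(** * The curve and the factorizations on it *)

Definition rad (t : C) : C := 3 * (t + 2) * (t + 7) * (3 * t ^ 2 + 3 * t + 2).

Definition rad' (t : C) : C := 36 * t ^ 3 + 270 * t ^ 2 + 426 * t + 180.

Definition T_odd (t : C) : C :=
  (27 * t ^ 10 + 270 * t ^ 9 + 945 * t ^ 8 + 2160 * t ^ 7 + 2745 * t ^ 6
   + 1926 * t ^ 5 - 5 * t ^ 4 - 1340 * t ^ 3 - 1440 * t ^ 2 - 720 * t - 216)
  / (6 * (t + 2) ^ 2 * (t ^ 2 + 1) ^ 2 * (3 * t ^ 2 + 3 * t + 2)).

Definition y_odd (t : C) : C :=
  (t + 7) * (45 * t ^ 6 + 144 * t ^ 5 + 258 * t ^ 4 + 228 * t ^ 3
             + 121 * t ^ 2 + 24 * t - 12)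
  / (6 * (5 * t ^ 2 + 4 * t + 3) * (t ^ 2 + 1) * (t + 2)).

(** [y_sextic] and [gap_quintic] are the factors of y (y - 1) and of y - T whose
    zeros are not zeros of T (T - 1). *)
Definition y_sextic (t : C) : C :=
  9 * t ^ 6 + 36 * t ^ 5 + 69 * t ^ 4 + 42 * t ^ 3 - 4 * t ^ 2 - 24 * t - 24.

Definition gap_quintic (t : C) : C :=
  3 * t ^ 5 + 15 * t ^ 4 + 15 * t ^ 3 + 45 * t ^ 2 + 40 * t + 26.

Definition T_prod (t : C) : C :=
  - (4 * (3 * t ^ 2 + 2 * t + 2) ^ 2 * (2 * t ^ 2 + 3 * t + 3) ^ 3 * (3 * t + 1) ^ 5)
  / (27 * (t + 2) ^ 5 * (t + 7) * (t ^ 2 + 1) ^ 4 * (3 * t ^ 2 + 3 * t + 2) ^ 3).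

Definition y_prod (t : C) : C :=
  5 * (3 * t ^ 2 + 2 * t + 2) * (2 * t ^ 2 + 3 * t + 3) * (3 * t + 1) ^ 2 * y_sextic t
  / (27 * (t + 2) ^ 3 * (t ^ 2 + 1) ^ 2 * (5 * t ^ 2 + 4 * t + 3) ^ 2
     * (3 * t ^ 2 + 3 * t + 2)).

Definition gap (t : C) : C :=
  (3 * t ^ 2 + 2 * t + 2) * (2 * t ^ 2 + 3 * t + 3) * (3 * t + 1) ^ 2 * gap_quintic t
  / (3 * (t + 2) ^ 2 * (t ^ 2 + 1) ^ 2 * (3 * t ^ 2 + 3 * t + 2)
     * (5 * t ^ 2 + 4 * t + 3)).

(** r * dT/dt along the curve. *)
Definition T_speed (t : C) : C :=
  40 * (3 * t ^ 2 + 2 * t + 2) * (2 * t ^ 2 + 3 * t + 3) ^ 2 * (3 * t + 1) ^ 4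
  / (3 * (t + 2) ^ 3 * (t + 7) * (t ^ 2 + 1) ^ 3 * (3 * t ^ 2 + 3 * t + 2) ^ 2).

(** dy/dT; a function of t alone, as both dy/dt and dT/dt are odd in r. *)
Definition slope (t : C) : C :=
  - ((t + 2) * (t + 7) * (t ^ 2 + 1) * (3 * t ^ 2 + 3 * t + 2)
     * (27 * t ^ 11 + 144 * t ^ 10 + 519 * t ^ 9 + 588 * t ^ 8 - 543 * t ^ 7
        - 3132 * t ^ 6 - 5697 * t ^ 5 - 6522 * t ^ 4 - 5074 * t ^ 3 - 2846 * t ^ 2
        - 1032 * t - 240))
  / (4 * (3 * t ^ 2 + 2 * t + 2) * (5 * t ^ 2 + 4 * t + 3) ^ 2
     * (2 * t ^ 2 + 3 * t + 3) ^ 2 * (3 * t + 1) ^ 3).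

Definition slope_num' (t : C) : C :=
  29160 * t ^ 23 + 477252 * t ^ 22 + 3587733 * t ^ 21 + 17226513 * t ^ 20
  + 60042330 * t ^ 19 + 163333530 * t ^ 18 + 360027753 * t ^ 17
  + 663577617 * t ^ 16 + 1059323322 * t ^ 15 + 1527069450 * t ^ 14
  + 2069351295 * t ^ 13 + 2692272375 * t ^ 12 + 3331456310 * t ^ 11
  + 3810255670 * t ^ 10 + 3907854315 * t ^ 9 + 3514851315 * t ^ 8
  + 2728579278 * t ^ 7 + 1805524242 * t ^ 6 + 1003955032 * t ^ 5
  + 460603220 * t ^ 4 + 169190880 * t ^ 3 + 47472048 * t ^ 2 + 9209952 * t
  + 994752.

Definition slope' (t : C) : C :=
  - slope_num' t
  / (4 * (3 * t ^ 2 + 2 * t + 2) ^ 2 * (5 * t ^ 2 + 4 * t + 3) ^ 3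
     * (2 * t ^ 2 + 3 * t + 3) ^ 3 * (3 * t + 1) ^ 4).

(** The points t over which T and y are finite and r does not vanish. *)
Definition off_poles (t : C) : Prop :=
  t + 2 <> 0 /\ t + 7 <> 0 /\ t ^ 2 + 1 <> 0 /\ 3 * t ^ 2 + 3 * t + 2 <> 0 /\
  5 * t ^ 2 + 4 * t + 3 <> 0.

(** The points t at which T is neither 0 nor 1, as seen from [T_prod]; they are
    also those at which T is unramified, as seen from [T_speed]. *)
Definition off_branching (t : C) : Prop :=
  3 * t ^ 2 + 2 * t + 2 <> 0 /\ 2 * t ^ 2 + 3 * t + 3 <> 0 /\ 3 * t + 1 <> 0.

Lemma curve42_off_poles (t r : C) : curve42 t r -> off_poles t /\ r <> 0.
Proof.
  intros (E & HT & Hy). unfold T42_den, y42_den in *.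
  assert (Hr : r <> 0) by (intros ->; apply HT; ring).
  repeat split; try exact Hr.
  - intros H; apply Hy; rewrite H; ring.
  - intros H. apply (Cpow_nz r 2 Hr). rewrite E, H; ring.
  - intros H; apply Hy; rewrite H; ring.
  - intros H; apply HT; rewrite H; ring.
  - intros H; apply Hy; rewrite H; ring.
Qed.

Lemma T42_odd (t r : C) : off_poles t -> r <> 0 -> T42 t r = 1 / 2 + T_odd t / r.
Proof.
  intros (Ha & Hb & Hc & Hq & Hs) Hr. unfold T42, T42_den, T_odd. field; tauto.
Qed.

Lemma y42_odd (t r : C) : off_poles t -> r <> 0 -> y42 t r = 1 / 2 + y_odd t / r.
Proof.
  intros (Ha & Hb & Hc & Hq & Hs) Hr. unfold y42, y42_den, y_odd. field; tauto.
Qed.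

(** The left-hand side is T (T - 1) = (T - 1/2)^2 - 1/4 with r^2 replaced by
    rad t; the next lemma treats y in the same way. *)
Lemma T_prod_spec (t : C) : off_poles t -> T_odd t ^ 2 / rad t - 1 / 4 = T_prod t.
Proof.
  intros (Ha & Hb & Hc & Hq & Hs). unfold T_odd, rad, T_prod. field; tauto.
Qed.

Lemma y_prod_spec (t : C) : off_poles t -> y_odd t ^ 2 / rad t - 1 / 4 = y_prod t.
Proof.
  intros (Ha & Hb & Hc & Hq & Hs). unfold y_odd, rad, y_prod, y_sextic. field; tauto.
Qed.

Lemma gap_spec (t : C) : off_poles t -> y_odd t - T_odd t = gap t.
Proof.
  intros (Ha & Hb & Hc & Hq & Hs). unfold y_odd, T_odd, gap, gap_quintic. field; tauto.
Qed.

Lemma T42_prod (t r : C) : curve42 t r -> T42 t r * (T42 t r - 1) = T_prod t.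
Proof.
  intros E. destruct (curve42_off_poles t r E) as [Ht Hr].
  rewrite T42_odd, <- T_prod_spec by assumption. rewrite <- (proj1 E : _ = rad t).
  field. exact Hr.
Qed.

Lemma y42_prod (t r : C) : curve42 t r -> y42 t r * (y42 t r - 1) = y_prod t.
Proof.
  intros E. destruct (curve42_off_poles t r E) as [Ht Hr].
  rewrite y42_odd, <- y_prod_spec by assumption. rewrite <- (proj1 E : _ = rad t).
  field. exact Hr.
Qed.

Lemma y42_minus_T42 (t r : C) : curve42 t r -> y42 t r - T42 t r = gap t / r.
Proof.
  intros E. destruct (curve42_off_poles t r E) as [Ht Hr].
  rewrite y42_odd, T42_odd, <- gap_spec by assumption. field. exact Hr.
Qed.

(** Regularity says T (T - 1), y (y - 1) and y - T are nonzero; the listed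
    polynomials are their numerators. *)
Lemma regular_off_branching (t r : C) :
  curve42 t r -> PVI_regular (T42 t r) (y42 t r) ->
  off_branching t /\ y_sextic t <> 0 /\ gap_quintic t <> 0.
Proof.
  intros E (HT0 & HT1 & Hy0 & Hy1 & HyT).
  apply Cminus_eq_contra in HT1, Hy1, HyT.
  pose proof (Cmult_neq_0 _ _ HT0 HT1) as Hu. rewrite (T42_prod t r E) in Hu.
  pose proof (Cmult_neq_0 _ _ Hy0 Hy1) as Hv. rewrite (y42_prod t r E) in Hv.
  rewrite (y42_minus_T42 t r E) in HyT.
  repeat split; intros H.
  - apply Hu. unfold T_prod, Cdiv. rewrite H. ring.
  - apply Hu. unfold T_prod, Cdiv. rewrite H. ring.
  - apply Hu. unfold T_prod, Cdiv. rewrite H. ring.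
  - apply Hv. unfold y_prod, Cdiv. rewrite H. ring.
  - apply HyT. unfold gap, Cdiv. rewrite H. ring.
Qed.

(** * Derivatives along the curve *)

Lemma is_derive_rad (t : C) : is_derive_C rad t (rad' t).
Proof.
  eapply is_derive_C_eq; [unfold rad; repeat derive_C|].
  simpl_derivative. unfold rad'. ring.
Qed.

(** d(f/r)/dt = (f' - f rad' / (2 rad)) / r on the curve.  The derivative of
    [T_odd], and below that of [y_odd], is therefore written as the numerator of
    dT/dt, resp. dy/dt, plus this correction. *)
Lemma is_derive_T_odd (t : C) : off_poles t ->
  is_derive_C T_odd t (T_speed t + T_odd t * rad' t / (2 * rad t)).
Proof.
  intros (Ha & Hb & Hc & Hq & Hs).
  eapply is_derive_C_eq; [unfold T_odd; repeat derive_C|].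
  - product_neq_0.
  - simpl_derivative. unfold T_odd, T_speed, rad, rad'. field; tauto.
Qed.

Lemma is_derive_y_odd (t : C) : off_poles t -> off_branching t ->
  is_derive_C y_odd t (slope t * T_speed t + y_odd t * rad' t / (2 * rad t)).
Proof.
  intros (Ha & Hb & Hc & Hq & Hs) (Hm & Hn & He).
  eapply is_derive_C_eq; [unfold y_odd; repeat derive_C|].
  - product_neq_0.
  - simpl_derivative. unfold y_odd, slope, T_speed, rad, rad'. field; tauto.
Qed.

Lemma is_derive_slope (t : C) : off_poles t -> off_branching t ->
  is_derive_C slope t (slope' t).
Proof.
  intros (Ha & Hb & Hc & Hq & Hs) (Hm & Hn & He).
  eapply is_derive_C_eq; [unfold slope; repeat derive_C|].
  - product_neq_0.
  - simpl_derivative. unfold slope', slope_num'. field; tauto.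
Qed.

Lemma T_speed_neq_0 (t : C) : off_poles t -> off_branching t -> T_speed t <> 0.
Proof.
  intros (Ha & Hb & Hc & Hq & Hs) (Hm & Hn & He).
  unfold T_speed, Cdiv. product_neq_0.
Qed.

(** With f' written as h plus the correction f rad' / (2 rad), the derivative of
    f/r along the curve loses the correction: it cancels against the derivative
    of 1/r, which is found by differentiating r^2 = rad t. *)
Lemma is_derive_over_root (f tau rho : C -> C) (U : C -> Prop) (s tau' h : C) :
  open (U : C_UniformSpace -> Prop) -> U s ->
  (forall w, U w -> rho w ^ 2 = rad (tau w)) -> rho s <> 0 ->
  is_derive_C tau s tau' -> @ex_derive C_AbsRing C_NormedModule rho s ->
  is_derive_C f (tau s) (h + f (tau s) * rad' (tau s) / (2 * rad (tau s))) ->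
  is_derive_C (fun w => 1 / 2 + f (tau w) / rho w) s (tau' * h / rho s).
Proof.
  intros HU Hs Hcurve Hr0 Htau [rho' Hrho] Hf. change C in rho'.
  assert (H2 : 2 * rho' * rho s = tau' * rad' (tau s)).
  { apply (is_derive_C_unique (fun w => rho w ^ 2) s).
    - eapply is_derive_C_eq; [apply is_derive_C_pow, Hrho|]. simpl_derivative. ring.
    - apply (is_derive_C_ext_open U (fun w => rad (tau w))); [exact HU | exact Hs | |].
      + intros w Hw. now rewrite Hcurve.
      + apply is_derive_C_comp; [apply is_derive_rad | exact Htau]. }
  assert (Hrho' : rho' = tau' * rad' (tau s) / (2 * rho s)).
  { rewrite <- H2. field. exact Hr0. }
  eapply is_derive_C_eq.
  - apply is_derive_C_plus; [apply is_derive_C_const|].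
    apply is_derive_C_div; [exact Hr0 | | exact Hrho].
    apply is_derive_C_comp; [exact Hf | exact Htau].
  - rewrite Hrho', <- (Hcurve s Hs). field. exact Hr0.
Qed.

(** * The equation at a point of the curve *)

(** With theta_0 = theta_1 = th the terms in beta and gamma combine by
    T/y^2 - (T-1)/(y-1)^2 = ((y - T)^2 - T(T-1)) / (y(y-1))^2, and each remaining
    pair of terms exchanged by (T, y) -> (1-T, 1-y) combines likewise. *)
Lemma PVI_rhs_symmetric (th thT thoo T y p : C) : PVI_regular T y ->
  let u := T * (T - 1) in
  let v := y * (y - 1) in
  PVI_rhs th th thT thoo T y p =
  1 / 2 * ((2 * y - 1) / v + 1 / (y - T)) * p ^ 2
  - ((2 * T - 1) / u + 1 / (y - T)) * p
  + v * (y - T) / u ^ 2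
    * ((thoo - 1) ^ 2 / 2 - th ^ 2 / 2 * (((y - T) ^ 2 - u) / v ^ 2)
       + (1 - thT ^ 2) / 2 * (u / (y - T) ^ 2)).
Proof.
  intros (HT0 & HT1 & Hy0 & Hy1 & HyT) u v. unfold u, v, PVI_rhs.
  apply Cminus_eq_contra in HT1, Hy1, HyT.
  field; tauto.
Qed.

(** The equation divided by r, with r^2 = rad t: the left-hand side is y''/r, and
    1/50, 1/18, 3/8 are alpha, gamma and delta. *)
Lemma PVI_reduced (t : C) :
  off_poles t -> off_branching t -> y_sextic t <> 0 -> gap_quintic t <> 0 ->
  slope' t / T_speed t =
  1 / 2 * (2 * y_odd t / (rad t * y_prod t) + 1 / gap t) * slope t ^ 2
  - (2 * T_odd t / (rad t * T_prod t) + 1 / gap t) * slope t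
  + y_prod t * gap t / (rad t * T_prod t ^ 2)
    * (1 / 50 - 1 / 18 * ((gap t ^ 2 / rad t - T_prod t) / y_prod t ^ 2)
       + 3 / 8 * (T_prod t * rad t / gap t ^ 2)).
Proof.
  intros (Ha & Hb & Hc & Hq & Hs) (Hm & Hn & He) HS HR.
  unfold slope', slope_num', T_speed, y_odd, T_odd, rad, y_prod, T_prod, gap, slope.
  unfold y_sextic, gap_quintic in *.
  field; tauto.
Qed.

Lemma PVI_on_curve (t r : C) :
  curve42 t r -> PVI_regular (T42 t r) (y42 t r) ->
  PVI_rhs (1 / 3) (1 / 3) (1 / 2) (4 / 5) (T42 t r) (y42 t r) (slope t)
  = r * slope' t / T_speed t.
Proof.
  intros E Hreg.
  destruct (curve42_off_poles t r E) as [Ht Hr].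
  destruct (regular_off_branching t r E Hreg) as (Hbr & HS & HR).
  pose proof (PVI_rhs_symmetric (1 / 3) (1 / 2) (4 / 5) _ _ (slope t) Hreg) as ->.
  pose proof Hreg as (HT0 & HT1 & Hy0 & Hy1 & HyT).
  apply Cminus_eq_contra in HT1, Hy1, HyT.
  pose proof (Cmult_neq_0 _ _ HT0 HT1) as Hu. rewrite (T42_prod t r E) in *.
  pose proof (Cmult_neq_0 _ _ Hy0 Hy1) as Hv. rewrite (y42_prod t r E) in *.
  rewrite (y42_minus_T42 t r E) in *.
  assert (Hg : gap t <> 0) by (intros H; apply HyT; rewrite H; unfold Cdiv; ring).
  rewrite T42_odd, y42_odd by assumption.
  replace (r * slope' t / T_speed t) with (r * (slope' t / T_speed t))
    by (unfold Cdiv; ring).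
  rewrite PVI_reduced by assumption. rewrite <- (proj1 E : _ = rad t).
  field. tauto.
Qed.

(** y' = slope tau and y'' = slope' tau * tau' by the chain rule, with
    tau' = rho / T_speed tau because s -> T (tau s, rho s) is the identity on an
    open set. *)
Lemma curve42_solves_PVI (U : C -> Prop) (tau rho : C -> C) :
  local_inverse curve42 T42 U tau rho ->
  (forall s : C, U s -> PVI_regular s (y42 (tau s) (rho s))) ->
  solves_PVI (1 / 3) (1 / 3) (1 / 2) (4 / 5) U (fun s => y42 (tau s) (rho s)).
Proof.
  intros [HU Hinv] Hreg.
  exists (fun s => slope (tau s)).
  exists (fun s => rho s * slope' (tau s) / T_speed (tau s)).
  intros s Hs.
  assert (Hcurve : forall w, U w -> rho w ^ 2 = rad (tau w)).
  { intros w Hw. destruct (Hinv w Hw) as (_ & _ & [Hc _] & _). exact Hc. }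
  destruct (Hinv s Hs) as ([tau' Htau] & Hrho & E & HT). change C in tau'.
  destruct (curve42_off_poles _ _ E) as [Ht Hr].
  pose proof (Hreg s Hs) as Hy. rewrite <- HT in Hy at 1.
  destruct (regular_off_branching _ _ E Hy) as (Hbr & HS & HR).
  pose proof (T_speed_neq_0 _ Ht Hbr) as Hsp.
  (* Differentiating T (tau w, rho w) = w. *)
  assert (Htau' : tau' = rho s / T_speed (tau s)).
  { assert (H1 : RtoC 1 = tau' * T_speed (tau s) / rho s).
    { apply (is_derive_C_unique (fun w => w) s); [apply is_derive_C_id|].
      apply (is_derive_C_ext_open U (fun w => 1 / 2 + T_odd (tau w) / rho w));
        [exact HU | exact Hs | |].
      - intros w Hw. destruct (Hinv w Hw) as (_ & _ & Ew & HTw).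
        destruct (curve42_off_poles _ _ Ew). now rewrite <- T42_odd.
      - apply (is_derive_over_root _ _ _ U); try assumption.
        now apply is_derive_T_odd. }
    replace (rho s / T_speed (tau s)) with (rho s * 1 / T_speed (tau s))
      by (field; exact Hsp).
    rewrite H1. field. tauto. }
  split; [exact (Hreg s Hs) | split; [| split]].
  - apply (is_derive_C_ext_open U (fun w => 1 / 2 + y_odd (tau w) / rho w));
      [exact HU | exact Hs | |].
    + intros w Hw. destruct (Hinv w Hw) as (_ & _ & Ew & _).
      destruct (curve42_off_poles _ _ Ew). now rewrite <- y42_odd.
    + eapply is_derive_C_eq.
      * apply (is_derive_over_root _ _ _ U); try eassumption.
        now apply is_derive_y_odd.
      * rewrite Htau'. field. tauto.
  - eapply is_derive_C_eq.
    + apply is_derive_C_comp; [now apply is_derive_slope | exact Htau].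
    + rewrite Htau'. field. exact Hsp.
  - pose proof (PVI_on_curve _ _ E Hy) as HPVI. rewrite HT in HPVI.
    symmetry. exact HPVI.
Qed.

Lemma curve42_point (r : C) : r = 24 \/ r = - (24) -> curve42 1 r.
Proof.
  intros Hr.
  assert (Hr0 : r <> 0).
  { destruct Hr as [-> | ->]; [|rewrite <- RtoC_opp]; apply RtoC_neq; lra. }
  split; [destruct Hr as [-> | ->]; ring | split].
  - replace (T42_den 1 r) with (1728 * r) by (unfold T42_den; ring). product_neq_0.
  - replace (y42_den 1 r) with (432 * r) by (unfold y42_den; ring). product_neq_0.
Qed.

(** At t = 1 the branch r = 24 has T and y rational, and on the conjugate branch T
    is replaced by 1 - T. *)
Lemma T42_point : T42 1 24 = (49 / 81)%R.
Proof. rewrite RtoC_div by lra. unfold T42, T42_den. field. Qed.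

Lemma T42_conjugate_point : T42 1 (- (24)) = (32 / 81)%R.
Proof. rewrite RtoC_div by lra. unfold T42, T42_den. field. Qed.

Lemma y42_point : y42 1 24 = (91 / 81)%R.
Proof. rewrite RtoC_div by lra. unfold y42, y42_den. field. Qed.

Theorem mainTheorem6 :
  parametrizes_PVI_solution (1 / 3) (1 / 3) (1 / 2) (4 / 5) curve42 T42 y42.
Proof.
  split; [|split].
  - exists 1, 24, 1, (- (24)). split; [|split].
    + apply curve42_point. now left.
    + apply curve42_point. now right.
    + rewrite T42_point, T42_conjugate_point. apply RtoC_neq. lra.
  - exists 1, 24. split; [apply curve42_point; now left|].
    rewrite T42_point, y42_point. repeat split; apply RtoC_neq; lra.
  - exact curve42_solves_PVI.
Qed.
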